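(* Let $G=(V,E)$ be a graph and let $(V_1,U,V_2)$ with grouping $\mathcal{U}$ be a node cutset separation of $G$. Let $G_1=G_{V_1\cup U}$ and $G_2=G_{V_2\cup U}$, let $\mathcal{L}_1$ be a collection of cliques in $G_1$ and $\mathcal{L}_2$ a collection of cliques in $G_2$. Then every $x\in\mathbb{R}^{V\cup\mathcal{R}(U)}$ satisfies $$x\in P(G(U),\mathcal{L}_1\cup\mathcal{L}_2\cup\mathcal{L}(U))\iff x_{G_1(U)}\in P(G_1(U),\mathcal{L}_1\cup\mathcal{L}(U))\text{ and }x_{G_2(U)}\in P(G_2(U),\mathcal{L}_2\cup\mathcal{L}(U)).$$ Consequently, $$P(G)=\{x\in\mathbb{R}^V:\exists y\in\mathbb{R}^{\mathcal{R}(U)}\,[(x_{G_1},y)\in P(G_1(U),\mathcal{L}(U))\text{ and }(x_{G_2},y)\in P(G_2(U),\mathcal{L}(U))]\}.$$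
   Context: For $X\subseteq V$, $G_X$ is the induced subgraph on $X$; for a vector $x$ and a graph $H$ whose node set is a subset of the index set, $x_H$ denotes the restriction of $x$ to the nodes of $H$. Disjoint sets $X,Y$ are adjacent if some node of $X$ has a neighbor in $Y$, fully adjacent if every node of $X$ is adjacent to every node of $Y$. For a graph $H$ and nonempty $X\subseteq V(H)$, $X$ is a group of $H$ if $X$ is fully adjacent to the set of nodes outside $X$ having a neighbor in $X$; a grouping of $A$ in $H$ is a partition of $A$ into groups of $H$. A node cutset separation of $G$ is a triple $(V_1,U,V_2)$ of disjoint sets with union $V$ together with a grouping $\mathcal{U}$ of $U$ in $G_{V_2\cup U}$ such that $V_1$ and $V_2$ are nonadjacent, $|V_1\cup U|>|\mathcal{U}|$ and $|V_2|>0$. For $U\subseteq V(H)$, the record graph $H(U)$ is obtained from $H$ by adding a clique $\mathcal{R}(U)$ of new nodes $r_S$, one for each stable set $S$ of $G_U$ (including $\emptyset$), where $r_S$ is adjacent to all nodes of $U\setminus S$ and to no other node of $H$ (the same set $\mathcal{R}(U)$ is used for $G,G_1,G_2$ since they induce the same graph on $U$). $\mathcal{L}(U)$ is the collection consisting of the clique $\mathcal{R}(U)$ together with the cliques $\{v\}\cup\{r_T: T \text{ stable in } G_U,\ v\notin T\}$ for $v\in U$. For a graph $H$ and a collection $\mathcal{L}$ of cliques of $H$, $P(H,\mathcal{L})$ is the convex hull of characteristic vectors of stable sets of $H$ that intersect every member of $\mathcal{L}$, and $P(H)=P(H,\emptyset)$ is the stable set polytope. *)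

(* Defs.v *)
From HB Require Import structures.
From mathcomp Require Import all_boot all_order all_algebra.
From mathcomp Require Import classical_sets reals.

Set Implicit Arguments.
Unset Strict Implicit.
Unset Printing Implicit Defensive.

Import Order.TTheory GRing.Theory Num.Theory.
Local Open Scope ring_scope.

(* The node set is a subset of an ambient finite type T, so that a graph, its
   induced subgraphs and their record graphs literally share nodes. *)
Record sgraph (T : finType) := SGraph {
  nodes : {set T};
  adj : rel T;
  adj_nodes : forall u v, adj u v -> (u \in nodes) && (v \in nodes);
  adj_sym : symmetric adj;
  adj_irr : irreflexive adj
}.

Section Graphs.
Variable T : finType.
Implicit Types (H : sgraph T) (X Y A S C U : {set T}).

Section Induced.
Variables (H : sgraph T) (X : {set T}).

Definition induced_adj (u v : T) : bool :=
  [&& u \in X, v \in X & adj H u v].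

Fact induced_adj_nodes u v :
  induced_adj u v -> (u \in nodes H :&: X) && (v \in nodes H :&: X).
Proof. by case/and3P=> uX vX /adj_nodes/andP[uH vH]; rewrite !inE uX vX uH vH. Qed.

Fact induced_adj_sym : symmetric induced_adj.
Proof. by move=> u v; rewrite /induced_adj adj_sym andbCA. Qed.

Fact induced_adj_irr : irreflexive induced_adj.
Proof. by move=> u; rewrite /induced_adj adj_irr !andbF. Qed.

Definition induced : sgraph T :=
  SGraph induced_adj_nodes induced_adj_sym induced_adj_irr.
End Induced.

Definition adjacent H X Y : bool := [exists u in X, exists v in Y, adj H u v].

Definition fully_adjacent H X Y : bool :=
  [forall u in X, forall v in Y, adj H u v].

Definition stable H S : bool :=
  (S \subset nodes H) && [forall u in S, forall v in S, ~~ adj H u v].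

Definition clique H C : bool :=
  (C \subset nodes H) && [forall u in C, forall v in C, (u != v) ==> adj H u v].

Definition outer_neighbors H X : {set T} :=
  [set w in nodes H | (w \notin X) && [exists u in X, adj H u w]].

Definition group H X : bool :=
  [&& X != finset.set0, X \subset nodes H
    & fully_adjacent H X (outer_neighbors H X)].

Definition grouping H A (P : {set {set T}}) : bool :=
  finset.partition P A && [forall X in P, group H X].

Record node_cutset_separation (G : sgraph T) (V1 U V2 : {set T})
    (UU : {set {set T}}) : Prop := NodeCutsetSeparation {
  ncs_cover : V1 :|: U :|: V2 = nodes G;
  ncs_disj1U : [disjoint V1 & U];
  ncs_disj12 : [disjoint V1 & V2];
  ncs_disjU2 : [disjoint U & V2];
  ncs_grouping : grouping (induced G (V2 :|: U)) U UU;
  ncs_nonadj : ~~ adjacent G V1 V2;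
  ncs_left : (#|UU| < #|V1 :|: U|)%N;
  ncs_right : (0 < #|V2|)%N
}.

(* The index set of the record nodes: S stands for r_S. *)
Definition rec_index H U : {set {set T}} :=
  [set S | stable (induced H U) S].

(* The record nodes depend only on the subgraph induced on U. *)
Lemma rec_index_induced H U X : U \subset X ->
  rec_index (induced H X) U = rec_index H U.
Proof.
move=> /fintype.subsetP UX; apply/setP=> S; rewrite !inE /stable /=.
congr andb.
  suff -> : nodes H :&: X :&: U = nodes H :&: U by [].
  apply/setP=> v; rewrite !inE; case: (boolP (v \in U)) => [/UX ->|_].
    by rewrite !andbT.
  by rewrite !andbF.
apply: eq_forallb => u; congr (_ ==> _); apply: eq_forallb => v.
congr (_ ==> ~~ _); rewrite /induced_adj /= /induced_adj.
case: (boolP (u \in U)) => //= /UX ->; case: (boolP (v \in U)) => //= /UX ->.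
by [].
Qed.
End Graphs.

(* The record graph H(U); inl v is the node v of H and inr S is r_S. *)
Section RecordGraph.
Variables (T : finType) (H : sgraph T) (U : {set T}).

Definition record_nodes : {set T + {set T}} :=
  [set inl v | v in nodes H] :|: [set inr S | S in rec_index H U].

Definition record_adj (a b : T + {set T}) : bool :=
  match a, b with
  | inl u, inl v => adj H u v
  | inl u, inr A | inr A, inl u =>
      [&& u \in nodes H, A \in rec_index H U & u \in U :\: A]
  | inr A, inr B =>
      [&& A \in rec_index H U, B \in rec_index H U & A != B]
  end.

Fact record_adj_nodes a b :
  record_adj a b -> (a \in record_nodes) && (b \in record_nodes).
Proof.
rewrite /record_nodes !finset.in_setU; case: a b => [u|S] [v|S'] /=.
- by move=> /adj_nodes/andP[uH vH]; rewrite !imset_f.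
- by case/and3P=> uH SR _; rewrite !imset_f // orbT.
- by case/and3P=> uH SR _; rewrite !imset_f // orbT.
- by case/and3P=> SR SR' _; rewrite !imset_f // !orbT.
Qed.

Fact record_adj_sym : symmetric record_adj.
Proof.
by move=> [u|S] [v|S'] //=; [exact: adj_sym | rewrite andbCA (eq_sym S)].
Qed.

Fact record_adj_irr : irreflexive record_adj.
Proof. by move=> [u|S] /=; [exact: adj_irr | rewrite eqxx !andbF]. Qed.

Definition record_graph : sgraph (T + {set T})%type :=
  SGraph record_adj_nodes record_adj_sym record_adj_irr.

Definition record_cliques : {set {set T + {set T}}} :=
  [set inr S | S in rec_index H U]
  |: [set inl v |: [set inr S | S in [set S in rec_index H U | v \notin S]]
      | v in U].
End RecordGraph.

(* A collection of node sets of H, viewed in H(U). *)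
Definition lift_sets (T : finType) (L : {set {set T}}) :
    {set {set T + {set T}}} :=
  [set [set inl v | v in C : {set T}] | C : {set T} in L].

Section Vectors.
Variable R : realType.

Definition vec (T : finType) (A : {set T}) := {ffun {v : T | v \in A} -> R}.

(* Coordinate lookup by node; the value 0 is used only outside of A. *)
Definition coord (T : finType) (A : {set T}) (x : vec A) (v : T) : R :=
  if insub v is Some i then x i else 0.

(* x_B; meaningful for B \subset A. *)
Definition restr (T : finType) (A B : {set T}) (x : vec A) : vec B :=
  [ffun i => coord x (val i)].

(* (x, y) indexed by the node set of a record graph; meaningful for
   C = inl @: A :|: inr @: B. *)
Definition vjoin (T T' : finType) (A : {set T}) (B : {set T'})
    (C : {set T + T'}) (x : vec A) (y : vec B) : vec C :=
  [ffun i => match val i with inl v => coord x v | inr w => coord y w end].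

Definition char_vec (T : finType) (A S : {set T}) : vec A :=
  [ffun i => (val i \in S)%:R].

Definition conv (I : finType) (D : set {ffun I -> R}) : set {ffun I -> R} :=
  [set x | exists (n : nat) (p : 'I_n -> {ffun I -> R}) (c : 'I_n -> R),
    [/\ forall k, D (p k), forall k, 0 <= c k, \sum_k c k = 1
      & forall i, x i = \sum_k c k * p k i]]%classic.

Definition stabP (T : finType) (H : sgraph T) (L : {set {set T}}) :
    set (vec (nodes H)) :=
  conv [set x | exists S : {set T},
    [/\ stable H S, forall C, C \in L -> S :&: C != finset.set0
      & x = char_vec (nodes H) S]]%classic.
End Vectors.

Arguments restr {R T A} B x.
Arguments vjoin {R T T' A B} C x y.
Arguments char_vec R {T} A S.
Arguments stabP R {T} H L.

(* Main.v *)
(* A stable set of the record graph that meets every record clique contains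
   exactly one record node r_S, and its trace on U is then S.  Hence, if a
   point is written as a convex combination of such sets on either side, the
   total weight of the sets with trace S is the coordinate at r_S, the same on
   both sides.  The two combinations can therefore be coupled so that only sets
   with equal traces are paired, and the union of such a pair is stable because
   V1 and V2 are nonadjacent. *)
Require Import Defs.
From HB Require Import structures.
From mathcomp Require Import all_boot all_order all_algebra.
From mathcomp Require Import classical_sets reals.

Set Implicit Arguments.
Unset Strict Implicit.
Unset Printing Implicit Defensive.

Import Order.TTheory GRing.Theory Num.Theory.
Local Open Scope ring_scope.

Local Notation coord := Defs.coord.

(** * Coordinates of vectors indexed by node sets *)

Lemma coordE (R : realType) (T : finType) (A : {set T}) (x : vec R A)
    (i : {v : T | v \in A}) : coord x (val i) = x i.
Proof. by rewrite /coord valK. Qed.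

Lemma coord_ffun (R : realType) (T : finType) (A : {set T}) (f : T -> R) v :
  v \in A -> coord ([ffun i => f (val i)] : vec R A) v = f v.
Proof. by move=> vA; rewrite -[v]/(val (exist _ v vA)) coordE ffunE. Qed.

Lemma coord_restr (R : realType) (T : finType) (A B : {set T}) (x : vec R A) v :
  v \in B -> coord (restr B x) v = coord x v.
Proof. exact: coord_ffun. Qed.

Lemma coord_vjoin (R : realType) (T T' : finType) (A : {set T}) (B : {set T'})
    (C : {set T + T'}) (x : vec R A) (y : vec R B) w :
  w \in C ->
  coord (vjoin C x y) w =
    match w with inl v => coord x v | inr v => coord y v end.
Proof.
exact: (coord_ffun (fun w =>
  match w with inl v => coord x v | inr v => coord y v end)).
Qed.

(** * Convex combinations of stable sets and their coupling *)

Definition transversal_stable (T : finType) (H : sgraph T) (L : {set {set T}})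
    (S : {set T}) : Prop :=
  stable H S /\ forall C, C \in L -> S :&: C != finset.set0.

(** The index type is arbitrary so that pairs can serve as indices. Sets of weight 0 are
    unconstrained because a coupling gives weight 0 to pairs whose traces differ. *)
Definition mixture (R : realType) (T : finType) (H : sgraph T)
    (L : {set {set T}}) (x : vec R (nodes H)) (I : finType)
    (S : I -> {set T}) (c : I -> R) : Prop :=
  [/\ forall i, 0 <= c i, \sum_i c i = 1,
      forall i, c i != 0 -> transversal_stable H L (S i)
    & forall v, v \in nodes H -> coord x v = \sum_i c i * (v \in S i)%:R].

Lemma stabP_mixture (R : realType) (T : finType) (H : sgraph T)
    (L : {set {set T}}) (x : vec R (nodes H)) :
  stabP R H L x -> exists (I : finType) S c, @mixture R T H L x I S c.
Proof.
case=> n [p [c [Dp c0 c1 xE]]].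
(* The boolean form lets [xchoose] pick one stable set for each point [p k]. *)
have goodP k : [exists S : {set T}, [&& stable H S,
    [forall C in L, S :&: C != finset.set0] & p k == char_vec R (nodes H) S]].
  have [S [stS hS pS]] := Dp k; apply/existsP; exists S.
  by rewrite stS pS eqxx andbT /=; apply/forall_inP.
exists 'I_n, (fun k => xchoose (existsP (goodP k))), c.
split=> // [k _|v vH].
  have /and3P[stS /forall_inP hS _] := xchooseP (existsP (goodP k)).
  by split.
rewrite -[v]/(val (exist _ v vH)) coordE xE; apply: eq_bigr => k _.
by have /and3P[_ _ /eqP{1}->] := xchooseP (existsP (goodP k)); rewrite ffunE.
Qed.

Lemma mixture_stabP (R : realType) (T : finType) (H : sgraph T)
    (L : {set {set T}}) (x : vec R (nodes H)) (I : finType) S c :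
  @mixture R T H L x I S c -> stabP R H L x.
Proof.
(* Indices of weight 0 may carry arbitrary sets, so only the support of [c] is enumerated. *)
case=> c0 c1 good xE; pose A := [set i | c i != 0].
have sumA (F : I -> R) : (forall i, c i = 0 -> F i = 0) ->
    \sum_i F i = \sum_(k < #|A|) F (enum_val k).
  move=> F0; rewrite -(big_enum_val F) [RHS]big_mkcond /=.
  by apply: eq_bigr => i _; rewrite inE; case: eqP => //= /F0.
exists #|A|, (fun k => char_vec R (nodes H) (S (enum_val k))),
  (fun k => c (enum_val k)); split=> [k|//||i].
- have := enum_valP k; rewrite inE => /good[stS hS].
  by exists (S (enum_val k)).
- by rewrite -sumA.
- rewrite -coordE xE ?(valP i) // sumA => [|j ->]; last by rewrite mul0r.
  by apply: eq_bigr => k _; rewrite ffunE.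
Qed.

(** Reading coordinates through [f] is linear, so it suffices to transform the stable sets. The
    cases used are [f = id] (restriction to a subgraph) and [f = inl] (forgetting the record
    nodes). *)
Lemma stabP_map (R : realType) (T T' : finType) (H : sgraph T) (H' : sgraph T')
    (L : {set {set T}}) (L' : {set {set T'}}) (f : T' -> T)
    (x : vec R (nodes H)) (x' : vec R (nodes H')) :
  (forall v, v \in nodes H' ->
     f v \in nodes H /\ coord x' v = coord x (f v)) ->
  (forall S, transversal_stable H L S ->
     transversal_stable H' L' (f @^-1: S :&: nodes H')) ->
  stabP R H L x -> stabP R H' L' x'.
Proof.
move=> fP goodP /stabP_mixture[I [S [c [c0 c1 good xE]]]].
apply: (@mixture_stabP _ _ _ _ _ I (fun i => f @^-1: S i :&: nodes H') c).
split=> // [i /good /goodP //|v vH'].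
have [fvH ->] := fP v vH'; rewrite xE //.
by apply: eq_bigr => i _; rewrite !inE vH' andbT.
Qed.

(* Conditionally on the key, the two indices are drawn independently. *)
Lemma coupling (R : realType) (I J : finType) (K : eqType)
    (a : I -> K) (b : J -> K) (c : I -> R) (d : J -> R) :
  (forall i, 0 <= c i) -> (forall j, 0 <= d j) ->
  (forall k, \sum_(i | a i == k) c i = \sum_(j | b j == k) d j) ->
  exists e : I -> J -> R,
    [/\ forall i j, 0 <= e i j,
        forall i j, e i j != 0 -> [/\ a i = b j, c i != 0 & d j != 0],
        forall i, \sum_j e i j = c i
      & forall j, \sum_i e i j = d j].
Proof.
move=> c0 d0 cd; pose z k := \sum_(i | a i == k) c i.
(* A key may have total weight 0, where division by [z] yields 0. Nonnegativity then forces every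
   weight with that key to vanish, so the marginals remain correct. *)
have zc i : z (a i) = 0 -> c i = 0.
  move=> /eqP; rewrite psumr_eq0 // => /allP/(_ i (mem_index_enum i)).
  by rewrite eqxx => /eqP.
have zd j : z (b j) = 0 -> d j = 0.
  rewrite /z cd => /eqP; rewrite psumr_eq0 // => /allP/(_ j (mem_index_enum j)).
  by rewrite eqxx => /eqP.
exists (fun i j => if a i == b j then c i * d j / z (a i) else 0); split.
- move=> i j; case: ifP => // _.
  by rewrite divr_ge0 ?mulr_ge0 // sumr_ge0.
- move=> i j; case: (a i =P b j) => [ab|_]; last by rewrite eqxx.
  by rewrite !mulf_eq0 !negb_or => /andP[/andP[]].
- move=> i; rewrite -big_mkcond /= -mulr_suml -mulr_sumr.
  under eq_bigl => j do rewrite eq_sym.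
  rewrite -cd -/(z _); have [/[dup] /zc -> ->|z0] := eqVneq (z (a i)) 0.
    by rewrite !mul0r.
  by rewrite mulfK.
- move=> j; rewrite -big_mkcond /=.
  under eq_bigr => i /eqP -> do rewrite -mulrA.
  rewrite -mulr_suml -/(z _).
  have [/[dup] /zd -> ->|z0] := eqVneq (z (b j)) 0; first by rewrite !mul0r.
  by rewrite mulrC divfK.
Qed.

(** * Amalgamating stable sets and polytopes along a common part *)

Lemma stable_restrict (T : finType) (H H1 : sgraph T) S :
  {in nodes H1 &, adj H1 =2 adj H} ->
  stable H S -> stable H1 (S :&: nodes H1).
Proof.
move=> adjE /andP[_ /forall_inP stS]; rewrite /stable subsetIr.
apply/forall_inP=> u /setIP[uS u1]; apply/forall_inP=> v /setIP[vS v1].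
by rewrite adjE //; move/forall_inP: (stS u uS); apply.
Qed.

(** By [cross], an edge from [S1] to [S2] would have an endpoint in the common part, where the two
    sets agree; its endpoints would then lie both in [S1] or both in [S2]. *)
Lemma stable_union (T : finType) (H H1 H2 : sgraph T) (S1 S2 : {set T}) :
  nodes H = nodes H1 :|: nodes H2 ->
  {in nodes H1 &, adj H1 =2 adj H} -> {in nodes H2 &, adj H2 =2 adj H} ->
  (forall u v, u \in nodes H1 -> v \in nodes H2 -> adj H u v ->
     (u \in nodes H2) || (v \in nodes H1)) ->
  S1 :&: (nodes H1 :&: nodes H2) = S2 :&: (nodes H1 :&: nodes H2) ->
  stable H1 S1 -> stable H2 S2 -> stable H (S1 :|: S2).
Proof.
move=> HE adj1 adj2 cross agree /andP[/fintype.subsetP S1H /forall_inP st1].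
move=> /andP[/fintype.subsetP S2H /forall_inP st2].
have in1 u v : u \in S1 -> v \in S1 -> ~~ adj H u v.
  by move=> uS vS; rewrite -adj1 ?S1H //; move/forall_inP: (st1 u uS); apply.
have in2 u v : u \in S2 -> v \in S2 -> ~~ adj H u v.
  by move=> uS vS; rewrite -adj2 ?S2H //; move/forall_inP: (st2 u uS); apply.
have agreeE v : v \in nodes H1 -> v \in nodes H2 -> (v \in S1) = (v \in S2).
  by move=> v1 v2; move/setP/(_ v): agree; rewrite !inE v1 v2 !andbT.
have in12 u v : u \in S1 -> v \in S2 -> ~~ adj H u v.
  move=> uS vS; apply/negP => uv.
  case/orP: (cross u v (S1H u uS) (S2H v vS) uv) => [u2|v1].
    by move: (in2 u v); rewrite -(agreeE u) ?S1H // uv => /(_ uS vS).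
  by move: (in1 u v); rewrite (agreeE v) ?S2H // uv => /(_ uS vS).
apply/andP; split.
  rewrite HE; apply: finset.setUSS; exact/fintype.subsetP.
apply/forall_inP=> u /setUP[] uS; apply/forall_inP=> v /setUP[] vS.
- exact: in1.
- exact: in12.
- by rewrite adj_sym in12.
- exact: in2.
Qed.

(* [marker]: the trace of a feasible stable set on the common part is visible
   in the single coordinate of some node [r]. *)
Lemma stabP_amalgam (R : realType) (T : finType) (H H1 H2 : sgraph T)
    (L1 L2 : {set {set T}}) (x : vec R (nodes H)) :
  nodes H = nodes H1 :|: nodes H2 ->
  {in nodes H1 &, adj H1 =2 adj H} -> {in nodes H2 &, adj H2 =2 adj H} ->
  (forall u v, u \in nodes H1 -> v \in nodes H2 -> adj H u v ->
     (u \in nodes H2) || (v \in nodes H1)) ->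
  (forall C, C \in L1 -> C \subset nodes H1) ->
  (forall C, C \in L2 -> C \subset nodes H2) ->
  let feasible S := transversal_stable H1 L1 S \/ transversal_stable H2 L2 S in
  let N := nodes H1 :&: nodes H2 in
  forall marker : forall S, feasible S -> exists2 r, r \in N &
    forall S', feasible S' -> (r \in S') = (S' :&: N == S :&: N),
  stabP R H (L1 :|: L2) x <->
  stabP R H1 L1 (restr (nodes H1) x) /\ stabP R H2 L2 (restr (nodes H2) x).
Proof.
move=> HE adj1 adj2 cross L1H L2H feasible N marker; split=> [Px|].
  (* Intersecting with [nodes H'] loses no hit, since each member of [L'] lies inside [nodes H']. *)
  have HP H' (L' : {set {set T}}) : nodes H' \subset nodes H ->
      {in nodes H' &, adj H' =2 adj H} -> L' \subset L1 :|: L2 ->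
      (forall C, C \in L' -> C \subset nodes H') ->
      stabP R H' L' (restr (nodes H') x).
    move=> /fintype.subsetP H'H adj' /fintype.subsetP LL' L'H'.
    apply: (@stabP_map _ _ _ _ _ _ _ id) Px => [v v'|S [stS hS]].
      by rewrite coord_restr // H'H.
    have -> : id @^-1: S = S by apply/setP=> v; rewrite inE.
    split=> [|C CL].
      exact: stable_restrict stS.
    rewrite -finset.setIA (finset.setIidPr (L'H' C CL)).
    exact: hS (LL' C CL).
  by split; apply: HP; rewrite ?HE ?finset.subsetUl ?finset.subsetUr.
case=> /stabP_mixture[I [S1 [c [c0 c1 good1 xE1]]]].
move=> /stabP_mixture[J [S2 [d [d0 d1 good2 xE2]]]].
have sum_key k :
    \sum_(i | S1 i :&: N == k) c i = \sum_(j | S2 j :&: N == k) d j.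
  (* The marker of [S] lies in both node sets, so each mixture computes its coordinate in [x], and
     each time the result is the weight of the trace of [S]. *)
  have key S : feasible S -> k = S :&: N ->
      \sum_(i | S1 i :&: N == k) c i = \sum_(j | S2 j :&: N == k) d j.
    move=> fS ->; have [r /setIP[r1 r2] rP] := marker S fS.
    transitivity (coord x r).
      rewrite -(coord_restr x r1) xE1 // big_mkcond; apply: eq_bigr => i _.
      have [->|/good1 g] := eqVneq (c i) 0; first by rewrite mul0r if_same.
      by rewrite rP; [case: ifP; rewrite ?mulr1 ?mulr0|left].
    rewrite -(coord_restr x r2) xE2 // [RHS]big_mkcond; apply: eq_bigr => j _.
    have [->|/good2 g] := eqVneq (d j) 0; first by rewrite mul0r if_same.
    by rewrite rP; [case: ifP; rewrite ?mulr1 ?mulr0|right].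
  (* If some set of nonzero weight on either side has trace [k], it is feasible and supplies a
     marker; otherwise both sums are zero. *)
  have [/existsP[i /andP[/eqP ik /good1 g]]|no1] :=
      boolP [exists i, (S1 i :&: N == k) && (c i != 0)].
    by apply: (key (S1 i)); first left.
  have [/existsP[j /andP[/eqP jk /good2 g]]|no2] :=
      boolP [exists j, (S2 j :&: N == k) && (d j != 0)].
    by apply: (key (S2 j)); first right.
  move: no1 no2; rewrite !negb_exists => /forallP no1 /forallP no2.
  rewrite !big1 // => [j jk|i ik].
    by move: (no2 j); rewrite jk negbK => /eqP.
  by move: (no1 i); rewrite ik negbK => /eqP.
have [e [e0 eP ec ed]] := coupling c0 d0 sum_key.
apply: (@mixture_stabP _ _ _ _ _ (I * J)%type
  (fun ij => S1 ij.1 :|: S2 ij.2) (fun ij => e ij.1 ij.2)).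
have sum_pair (F : I -> J -> R) :
    \sum_(ij : I * J) F ij.1 ij.2 = \sum_i \sum_j F i j.
  by rewrite pair_bigA.
have common i j v : e i j != 0 -> v \in nodes H1 -> v \in nodes H2 ->
    (v \in S1 i) = (v \in S2 j).
  move=> /eP[/setP/(_ v) + _ _] v1 v2.
  by rewrite !inE v1 v2 !andbT.
split=> [ij|||v].
- exact: e0.
- by rewrite sum_pair -c1; apply: eq_bigr => i _; rewrite ec.
- case=> i j /= /eP[key /good1[st1 hit1] /good2[st2 hit2]]; split.
    exact: stable_union key st1 st2.
  move=> C /setUP[/hit1|/hit2] /set0Pn[v /setIP[vS vC]]; apply/set0Pn; exists v.
    by rewrite !inE vS vC.
  by rewrite !inE vS vC orbT.
- move=> vH; have /setUP[v1|v2]: v \in nodes H1 :|: nodes H2 by rewrite -HE.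
    (* Where the weight is nonzero, a node [v] of [S2 j] is common and hence in [S1 i], so on
       [nodes H1] the union may be replaced by [S1 i]. Summing out [j] leaves [c i]; the other half
       is symmetric. *)
    rewrite -(coord_restr x v1) xE1 //.
    rewrite (sum_pair (fun i j => e i j * (v \in S1 i :|: S2 j)%:R)).
    apply: eq_bigr => i _; rewrite -ec mulr_suml; apply: eq_bigr => j _.
    have [->|enz] := eqVneq (e i j) 0; first by rewrite !mul0r.
    rewrite inE; case: (boolP (v \in S2 j)) => [vS|]; last by rewrite orbF.
    have [_ _ /good2[/andP[/fintype.subsetP S2H _] _]] := eP i j enz.
    by rewrite (common i j) ?S2H // vS.
  rewrite -(coord_restr x v2) xE2 //.
  rewrite (sum_pair (fun i j => e i j * (v \in S1 i :|: S2 j)%:R)) exchange_big.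
  apply: eq_bigr => j _; rewrite -ed mulr_suml; apply: eq_bigr => i _.
  have [->|enz] := eqVneq (e i j) 0; first by rewrite !mul0r.
  rewrite inE; case: (boolP (v \in S1 i)) => [vS|//].
  have [_ /good1[/andP[/fintype.subsetP S1H _] _] _] := eP i j enz.
  by rewrite -(common i j) ?S1H // vS.
Qed.

(** * Record graphs and the stable sets meeting their record cliques *)

Lemma in_record_nodes_l (T : finType) (H : sgraph T) (U : {set T}) v :
  (inl v \in record_nodes H U) = (v \in nodes H).
Proof.
rewrite inE mem_imset; last exact: inl_inj.
by rewrite -[RHS]orbF; congr orb; apply/negbTE/imsetP => -[].
Qed.

Lemma in_record_nodes_r (T : finType) (H : sgraph T) (U A : {set T}) :
  (inr A \in record_nodes H U) = (A \in rec_index H U).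
Proof.
rewrite inE mem_imset; last exact: inr_inj.
by rewrite -[RHS]orFb; congr orb; apply/negbTE/imsetP => -[].
Qed.

Lemma record_cliques_induced (T : finType) (H : sgraph T) (U X : {set T}) :
  U \subset X -> record_cliques (induced H X) U = record_cliques H U.
Proof. by move=> UX; rewrite /record_cliques rec_index_induced. Qed.

Lemma record_clique_sub (T : finType) (H : sgraph T) (U : {set T}) C :
  U \subset nodes H -> C \in record_cliques H U -> C \subset record_nodes H U.
Proof.
move=> /fintype.subsetP UH /setU1P[->|/imsetP[v vU ->]].
  exact: finset.subsetUr.
apply/fintype.subsetP=> w /setU1P[->|/imsetP[A]].
  by rewrite in_record_nodes_l UH.
by rewrite inE => /andP[AU _] ->; rewrite in_record_nodes_r.
Qed.

(** Meeting the clique of all record nodes yields exactly one [inr A] in [W]. Its adjacency to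
    [U :\: A] excludes the nodes of [U] outside [A]. For [v] in [A], the record nodes [inr B] in the
    clique of [v] all have [v] outside [B], so that clique can only be met in [v]. *)
Lemma record_trace (T : finType) (H : sgraph T) (U : {set T})
    (L : {set {set T + {set T}}}) W :
  U \subset nodes H -> record_cliques H U \subset L ->
  transversal_stable (record_graph H U) L W ->
  exists2 A, A \in rec_index H U &
    (forall B, (inr B \in W) = (B == A)) /\
    (forall v, v \in U -> (inl v \in W) = (v \in A)).
Proof.
move=> /fintype.subsetP UH /fintype.subsetP LU [/andP[/fintype.subsetP WH]].
move=> /forall_inP stW hit.
have nadj a b : a \in W -> b \in W -> ~~ record_adj H U a b.
  by move=> aW bW; move/forall_inP: (stW a aW); apply.
have /set0Pn[w /setIP[AW /imsetP[A AU wE]]] := hit _ (LU _ (setU11 _ _)).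
rewrite {w}wE in AW; have WA B : (inr B \in W) = (B == A).
  apply/idP/eqP => [BW|->//]; apply/eqP.
  have := WH _ BW; rewrite in_record_nodes_r => BU.
  by have := nadj _ _ BW AW; rewrite /= BU AU negbK.
exists A => //; split=> // v vU; apply/idP/idP => [vW|vA].
  by have := nadj _ _ vW AW; rewrite /= UH // AU inE vU andbT negbK.
have LUv := imset_f (fun v => inl v |: [set inr S | S in
  [set S in rec_index H U | v \notin S]]) vU.
have /set0Pn[w /setIP[wW /setU1P[<-//|/imsetP[B]]]] :=
  hit _ (LU _ (setU1r _ LUv)).
rewrite inE => /andP[_ vB] wB; move: wW vB.
by rewrite wB WA => /eqP ->; rewrite vA.
Qed.

Lemma record_adj_induced (T : finType) (H : sgraph T) (U X : {set T}) :
  U \subset X ->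
  {in record_nodes (induced H X) U &,
    record_adj (induced H X) U =2 record_adj H U}.
Proof.
move=> UX [u|A] [v|B]; rewrite ?in_record_nodes_l ?in_record_nodes_r /=;
  rewrite ?rec_index_induced //.
- by move=> /setIP[_ uX] /setIP[_ vX]; rewrite /induced_adj uX vX.
- by move=> /setIP[uH uX] _; rewrite inE uH uX.
- by move=> _ /setIP[vH vX]; rewrite inE vH vX.
Qed.

(** Among the nodes of [G], the record node of [S :&: U] is adjacent only to nodes of [U] outside
    [S]. This lifts the generators of the stable set polytope of [G] to the record graph. *)
Lemma record_extend (T : finType) (G : sgraph T) (U S : {set T}) :
  U \subset nodes G -> stable G S ->
  transversal_stable (record_graph G U) (record_cliques G U)
    (inr (S :&: U) |: [set inl v | v in S]).
Proof.
move=> /fintype.subsetP UG /andP[/fintype.subsetP SG /forall_inP stS].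
have nadj u v : u \in S -> v \in S -> ~~ adj G u v.
  by move=> uS vS; move/forall_inP: (stS u uS); apply.
have SUR : S :&: U \in rec_index G U.
  rewrite inE; apply/andP; split.
    by apply/fintype.subsetP=> v /setIP[vS vU]; rewrite inE UG.
  apply/forall_inP=> u /setIP[uS _]; apply/forall_inP=> v /setIP[vS _].
  by rewrite /= /induced_adj !negb_and nadj // !orbT.
split.
  apply/andP; split.
    apply/fintype.subsetP=> w /setU1P[->|/imsetP[v /SG vG ->]] /=.
      by rewrite in_record_nodes_r.
    by rewrite in_record_nodes_l.
  apply/forall_inP=> a /setU1P[->|/imsetP[u uS ->]];
  apply/forall_inP=> b /setU1P[->|/imsetP[v vS ->]] /=.
  - by rewrite eqxx !andbF.
  - by rewrite !inE vS /= andNb !andbF.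
  - by rewrite !inE uS /= andNb !andbF.
  - exact: nadj.
move=> C /setU1P[->|/imsetP[v vU ->]]; apply/set0Pn.
  by exists (inr (S :&: U)); rewrite !inE eqxx imset_f.
(* The clique of [v] is met in [v] itself if [v] is in [S], and otherwise in the record node, whose
   index then omits [v]. *)
have [vS|vS] := boolP (v \in S).
  by exists (inl v); rewrite !inE eqxx imset_f.
exists (inr (S :&: U)); rewrite !inE eqxx /=.
by rewrite imset_f // !inE negb_and vS andbT; move: SUR; rewrite !inE.
Qed.

(** * Application to the two sides of the separation *)

Lemma restr_vjoin (R : realType) (T T' : finType) (A A1 : {set T})
    (B : {set T'}) (C C1 : {set T + T'}) (x : vec R A) (y : vec R B) :
  (forall w, w \in C1 -> w \in C) -> (forall v, inl v \in C1 -> v \in A1) ->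
  restr C1 (vjoin C x y) = vjoin C1 (restr A1 x) y.
Proof.
move=> C1C C1A; apply/ffunP=> i; rewrite !ffunE coord_vjoin ?C1C ?(valP i) //.
by case E: (val i) => [v|//]; rewrite coord_restr // C1A // -E (valP i).
Qed.

(** The two record graphs overlap in [U] and the record nodes, and the record node of the trace
    serves as the marker required by [stabP_amalgam]. With empty collections this also gives the
    projection formula. *)
Lemma record_amalgam (R : realType) (T : finType) (G : sgraph T)
    (V1 U V2 : {set T}) (L1 L2 : {set {set T}})
    (x : vec R (nodes (record_graph G U))) :
  let G1 := induced G (V1 :|: U) in
  let G2 := induced G (V2 :|: U) in
  let LU := record_cliques G U in
  V1 :|: U :|: V2 = nodes G -> [disjoint V1 & V2] -> ~~ adjacent G V1 V2 ->
  (forall C, C \in L1 -> C \subset nodes G1) ->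
  (forall C, C \in L2 -> C \subset nodes G2) ->
  stabP R (record_graph G U) (lift_sets L1 :|: lift_sets L2 :|: LU) x <->
  stabP R (record_graph G1 U) (lift_sets L1 :|: LU)
    (restr (nodes (record_graph G1 U)) x) /\
  stabP R (record_graph G2 U) (lift_sets L2 :|: LU)
    (restr (nodes (record_graph G2 U)) x).
Proof.
move=> G1 G2 LU cover dis12 nonadj L1G L2G.
have U1 : U \subset V1 :|: U := finset.subsetUr _ _.
have U2 : U \subset V2 :|: U := finset.subsetUr _ _.
have nG v : (v \in nodes G) = [|| v \in V1, v \in U | v \in V2].
  by rewrite -cover !inE orbA.
have n1 v : (v \in nodes G1) = (v \in V1) || (v \in U).
  by rewrite !inE nG; case: (v \in V1); case: (v \in U); rewrite ?andbF.
have n2 v : (v \in nodes G2) = (v \in V2) || (v \in U).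
  by rewrite !inE nG; case: (v \in V2); case: (v \in U); rewrite ?andbF ?orbT.
have UG (X : {set T}) : U \subset X -> U \subset nodes (induced G X).
  move=> /fintype.subsetP UX; apply/fintype.subsetP=> v vU.
  by rewrite inE nG vU (UX v vU) orbT.
have liftP (X : {set T}) (L : {set {set T}}) : U \subset X ->
    (forall C, C \in L -> C \subset nodes (induced G X)) ->
    forall C, C \in lift_sets L :|: LU ->
    C \subset nodes (record_graph (induced G X) U).
  move=> UX LX C /setUP[/imsetP[D DL ->]|].
    apply/fintype.subsetP=> w /imsetP[v vD ->]; rewrite in_record_nodes_l.
    exact: (fintype.subsetP (LX D DL)).
  by rewrite /LU -(record_cliques_induced _ UX); apply/record_clique_sub/UG.
have traceP (X : {set T}) (L : {set {set T}}) S : U \subset X ->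
    transversal_stable (record_graph (induced G X) U) (lift_sets L :|: LU) S ->
    exists2 A, A \in rec_index G U & (forall B, (inr B \in S) = (B == A)) /\
      (forall v, v \in U -> (inl v \in S) = (v \in A)).
  move=> UX gS; rewrite -(rec_index_induced G UX).
  apply: (record_trace (UG X UX) _ gS).
  by rewrite record_cliques_induced // finset.subsetUr.
(* [LU] is distributed over the union so that both sides receive the record cliques. *)
rewrite finset.setUUl; apply: stabP_amalgam.
- apply/setP=> -[v|A]; rewrite finset.in_setU;
    rewrite ?in_record_nodes_l ?in_record_nodes_r.
    by rewrite n1 n2 nG; case: (v \in V1); case: (v \in U); case: (v \in V2).
  by rewrite !rec_index_induced // orbb.
- exact: record_adj_induced.
- exact: record_adj_induced.
(* Record nodes belong to both sides, so only edges between nodes of [G] matter; one with neither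
   end in [U] would join [V1] to [V2]. *)
- move=> [u|A] [v|B]; rewrite !(in_record_nodes_l, in_record_nodes_r);
    rewrite ?rec_index_induced //;
    [|by move=> _ -> _; rewrite orbT|by move->|by move->].
  rewrite !n1 !n2 => u1 v2 /= uv; apply: contraR nonadj.
  rewrite !negb_or => /andP[/andP[_ uU] /andP[_ vU]].
  move: u1 v2; rewrite (negPf uU) (negPf vU) !orbF => u1 v2.
  by apply/exists_inP; exists u => //; apply/exists_inP; exists v.
- exact: liftP.
- exact: liftP.
move=> /= S fS.
have feasible_trace S' :
    transversal_stable (record_graph G1 U) (lift_sets L1 :|: LU) S' \/
    transversal_stable (record_graph G2 U) (lift_sets L2 :|: LU) S' ->
    exists2 A, A \in rec_index G U & (forall B, (inr B \in S') = (B == A)) /\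
      (forall v, v \in U -> (inl v \in S') = (v \in A)).
  by case; apply: traceP.
have [A AU [SA SU]] := feasible_trace S fS.
have A12 : inr A \in record_nodes G1 U :&: record_nodes G2 U.
  by apply/setIP; rewrite !in_record_nodes_r !rec_index_induced.
exists (inr A) => // S' /feasible_trace[A' A'U [SA' SU']].
(* [inr A'] is the only record node of [S'], and [A'] fixes [S'] on [U]. Equal traces on the common
   part thus amount to [A' = A]. *)
apply/idP/eqP => [|/setP/(_ (inr A))]; last first.
  by rewrite !(finset.in_setI _ _ (record_nodes G1 U :&: _)) A12 SA eqxx andbT.
rewrite SA' => /eqP AA'; apply/setP=> w.
rewrite !(finset.in_setI _ _ (record_nodes G1 U :&: _)).
case: (boolP (w \in _ :&: _)) => [wN|]; rewrite ?andbF // !andbT.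
case: w wN => [v|B]; last by rewrite SA SA' AA'.
rewrite inE !in_record_nodes_l n1 n2 => /andP[v1 v2].
have vU : v \in U.
  move: v1 v2; case: (boolP (v \in U)) => // _; rewrite !orbF => v1.
  by rewrite (disjointFr dis12 v1).
by rewrite SU ?SU' // AA'.
Qed.

Theorem theorem9 (R : realType) (T : finType) (G : sgraph T)
    (V1 U V2 : {set T}) (UU : {set {set T}})
    (sep : node_cutset_separation G V1 U V2 UU)
    (L1 L2 : {set {set T}})
    (hL1 : forall C, C \in L1 -> clique (induced G (V1 :|: U)) C)
    (hL2 : forall C, C \in L2 -> clique (induced G (V2 :|: U)) C) :
  let G1 := induced G (V1 :|: U) in
  let G2 := induced G (V2 :|: U) in
  let GU := record_graph G U in
  let G1U := record_graph G1 U in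
  let G2U := record_graph G2 U in
  let LU := record_cliques G U in
  (forall x : vec R (nodes GU),
     stabP R GU (lift_sets L1 :|: lift_sets L2 :|: LU) x <->
     (stabP R G1U (lift_sets L1 :|: LU) (restr (nodes G1U) x) /\
      stabP R G2U (lift_sets L2 :|: LU) (restr (nodes G2U) x)))
  /\
  stabP R G finset.set0 =
    [set x : vec R (nodes G) | exists y : vec R (rec_index G U),
       stabP R G1U LU (vjoin (nodes G1U) (restr (nodes G1) x) y) /\
       stabP R G2U LU (vjoin (nodes G2U) (restr (nodes G2) x) y)]%classic.
Proof.
move=> G1 G2 GU G1U G2U LU.
case: sep => cover _ dis12 _ _ nonadj _ _.
have amalgam K1 K2 x :=
  @record_amalgam R T G V1 U V2 K1 K2 x cover dis12 nonadj.
split=> [x|].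
  by apply: amalgam => C; [case/hL1/andP | case/hL2/andP].
have UG : U \subset nodes G.
  by rewrite -cover -finset.setUA finset.setUCA finset.subsetUl.
have nodes_sub (X : {set T}) : U \subset X -> forall w,
    w \in nodes (record_graph (induced G X) U) -> w \in nodes GU.
  move=> UX [v|A]; rewrite !(in_record_nodes_l, in_record_nodes_r).
    by case/setIP.
  by rewrite rec_index_induced.
(* By amalgamation with empty collections, the right-hand side of the projection formula says that
   [(x, y)] lies in the polytope of the record graph of [G]. *)
have join_iff (x : vec R (nodes G)) (y : vec R (rec_index G U)) :
    stabP R GU LU (vjoin (nodes GU) x y) <->
    stabP R G1U LU (vjoin (nodes G1U) (restr (nodes G1) x) y) /\
    stabP R G2U LU (vjoin (nodes G2U) (restr (nodes G2) x) y).
  have := amalgam finset.set0 finset.set0 (vjoin (nodes GU) x y).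
  rewrite /lift_sets !imset0 !finset.set0U.
  have restrE (X : {set T}) : U \subset X ->
      restr (nodes (record_graph (induced G X) U)) (vjoin (nodes GU) x y) =
      vjoin _ (restr (nodes (induced G X)) x) y.
    move=> UX; apply: restr_vjoin => [w|v]; first exact: nodes_sub.
    by rewrite in_record_nodes_l.
  rewrite !restrE ?finset.subsetUr //; apply=> C; by rewrite inE.
apply/seteqP; split=> x /=.
  case/stabP_mixture=> I [S [c [c0 c1 good xE]]].
  (* At [A], the witness is the total weight of the sets with trace [A] on [U], which is what the
     lifted sets produce at the record node of [A]. *)
  pose y : vec R (rec_index G U) :=
    [ffun A => \sum_i c i * (val A == S i :&: U)%:R].
  exists y; apply/join_iff.
  apply: (@mixture_stabP _ _ _ _ _ I
    (fun i => inr (S i :&: U) |: [set inl v | v in S i]) c).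
  split=> // [i /good[stS _]|w wGU]; first exact: record_extend.
  rewrite coord_vjoin //; case: w wGU => [v|A].
    rewrite in_record_nodes_l => /xE ->; apply: eq_bigr => i _.
    by rewrite !inE mem_imset //; exact: inl_inj.
  rewrite in_record_nodes_r => AU.
  rewrite (coord_ffun (fun A => \sum_i c i * (A == S i :&: U)%:R)) //.
  apply: eq_bigr => i _; congr (_ * (nat_of_bool _)%:R).
  rewrite !inE (inj_eq inr_inj).
  by rewrite -[LHS]orbF; congr orb; apply/esym/imsetP => -[].
(* Conversely, forgetting the record nodes keeps sets stable, as the record graph has the same edges
   as [G] among the nodes of [G]. *)
case=> y /join_iff.
apply: (@stabP_map _ _ _ _ _ _ _ inl) => [v vG|W [/andP[_ /forall_inP stW] _]].
  by rewrite coord_vjoin ?in_record_nodes_l.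
split=> [|C]; last by rewrite inE.
apply/andP; split; first exact: finset.subsetIr.
apply/forall_inP=> u /setIP[+ _]; rewrite inE => /stW/forall_inP uW.
by apply/forall_inP=> v /setIP[+ _]; rewrite inE => /uW.
Qed.
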